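(* Let $\phi = \frac{1+\sqrt5}{2}$, $a(k) = \lfloor k\phi\rfloor$ and $c(k) = a(k)+2k-1$. Then for every positive integer $k$, \[ \{c(k)\phi\} = \begin{cases} \frac{\sqrt5}{\phi}\{k\phi\} + \frac{1-\sqrt5}{2}, & \text{if } \{k\phi\} > \frac{1}{\sqrt5},\\[0.3em] \frac{\sqrt5}{\phi}\{k\phi\} + \frac{3-\sqrt5}{2}, & \text{if } \{k\phi\} < \frac{1}{\sqrt5}.\end{cases} \]
   Context: $\{x\} = x - \lfloor x\rfloor$ denotes the fractional part. *)

(* Defs.v *)
From Stdlib Require Import Reals ZArith.

Open Scope R_scope.

Definition phi : R := (1 + sqrt 5) / 2.

(** [Int_part] is the floor function of the library, valued in [Z], and
    [frac_part x = x - IZR (Int_part x)]. *)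
Definition a (k : Z) : Z := Int_part (IZR k * phi).

Definition c (k : Z) : Z := (a k + 2 * k - 1)%Z.

(* Main.v *)
Require Import Defs.
From Stdlib Require Import Reals ZArith Lra Lia.

Open Scope R_scope.

(** Write [x] for the fractional part of [k * phi].  Since
    [phi ^ 2 = phi + 1], the number [c k * phi] is congruent to
    [sqrt 5 / phi * x - phi] modulo 1, and [x = 1 / sqrt 5] is exactly where
    this crosses an integer.  That value is not attained: it would give
    [(5 k - 2) ^ 2 = 5 (2 a(k) - k) ^ 2], which is impossible modulo 5. *)

Lemma frac_part_unique (r y : R) (z : Z) :
  r = IZR z + y -> 0 <= y < 1 -> frac_part r = y.
Proof.
  intros Hr Hy.
  unfold frac_part.
  rewrite <- (Int_part_spec r z); lra.
Qed.

Lemma sqrt5_sqr : sqrt 5 * sqrt 5 = 5.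
Proof. apply sqrt_sqrt; lra. Qed.

Lemma sqrt5_bounds : 2 < sqrt 5 < 3.
Proof.
  pose proof sqrt5_sqr; pose proof (sqrt_pos 5); split; nra.
Qed.

Lemma sqrt5_div_phi : sqrt 5 / phi = (5 - sqrt 5) / 2.
Proof.
  pose proof sqrt5_sqr; pose proof sqrt5_bounds.
  unfold phi.
  apply (Rmult_eq_reg_r ((1 + sqrt 5) / 2)); [| lra].
  unfold Rdiv at 1; rewrite Rmult_assoc, Rinv_l; nra.
Qed.

Lemma inv_sqrt5 : 1 / sqrt 5 = sqrt 5 / 5.
Proof.
  pose proof sqrt5_sqr; pose proof sqrt5_bounds.
  apply (Rmult_eq_reg_r (sqrt 5)); [| lra].
  unfold Rdiv at 1; rewrite Rmult_assoc, Rinv_l; nra.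
Qed.

Lemma mul_phi_sub_neq_inv_sqrt5 (k m : Z) : IZR k * phi - IZR m <> 1 / sqrt 5.
Proof.
  rewrite inv_sqrt5; unfold phi; intros H.
  pose proof sqrt5_sqr as Hs.
  (* Isolating [sqrt 5] lets one squaring turn the equation into one between integers. *)
  assert (Hlin : sqrt 5 * (5 * IZR k - 2) = 5 * (2 * IZR m - IZR k)) by lra.
  assert (Hsq : (5 * IZR k - 2) * (5 * IZR k - 2)
                = 5 * ((2 * IZR m - IZR k) * (2 * IZR m - IZR k))).
  { assert (E : (sqrt 5 * sqrt 5) * ((5 * IZR k - 2) * (5 * IZR k - 2))
                = 25 * ((2 * IZR m - IZR k) * (2 * IZR m - IZR k))).
    { replace ((sqrt 5 * sqrt 5) * ((5 * IZR k - 2) * (5 * IZR k - 2)))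
        with ((sqrt 5 * (5 * IZR k - 2)) * (sqrt 5 * (5 * IZR k - 2))) by ring.
      rewrite Hlin; ring. }
    rewrite Hs in E; lra. }
  assert (HZ : ((5 * k - 2) * (5 * k - 2) = 5 * ((2 * m - k) * (2 * m - k)))%Z).
  { apply eq_IZR.
    repeat (rewrite mult_IZR || rewrite minus_IZR).
    exact Hsq. }
  (* After expansion every term is a multiple of 5 except the constant 4 on the left. *)
  lia.
Qed.

(** Here [sqrt 5 / phi = 3 - phi], and [phi ^ 2 = phi + 1] expands [(3 - phi) * (k * phi - a k)] to
    [(a k + 2 * k) * phi - 3 * a k - k]. *)
Lemma c_mul_phi (k : Z) :
  IZR (c k) * phi
    = IZR (3 * a k + k) + (sqrt 5 / phi * frac_part (IZR k * phi) - phi).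
Proof.
  rewrite sqrt5_div_phi.
  unfold c, frac_part; fold (a k).
  rewrite minus_IZR, !plus_IZR, !mult_IZR.
  pose proof sqrt5_sqr as Hs.
  unfold phi; generalize dependent (sqrt 5); intros s Hs.
  (* [field_simplify] produces powers, so the relation is put in the form [s ^ 2 = 5] for the
     rewrite. *)
  replace (s * s) with (s ^ 2) in Hs by ring.
  field_simplify; rewrite Hs; field.
Qed.

Theorem theorem4p4 (k : Z) (hk : (0 < k)%Z) :
  (frac_part (IZR k * phi) > 1 / sqrt 5 /\
   frac_part (IZR (c k) * phi)
     = sqrt 5 / phi * frac_part (IZR k * phi) + (1 - sqrt 5) / 2)
  \/
  (frac_part (IZR k * phi) < 1 / sqrt 5 /\
   frac_part (IZR (c k) * phi)
     = sqrt 5 / phi * frac_part (IZR k * phi) + (3 - sqrt 5) / 2).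
Proof.
  pose proof (mul_phi_sub_neq_inv_sqrt5 k (a k)) as Hne.
  change (frac_part (IZR k * phi) <> 1 / sqrt 5) in Hne.
  pose proof (base_fp (IZR k * phi)) as [Hx0 Hx1].
  pose proof (c_mul_phi k) as Hc.
  pose proof sqrt5_sqr as Hs; pose proof sqrt5_bounds as Hb.
  rewrite sqrt5_div_phi, inv_sqrt5 in *.
  set (x := frac_part (IZR k * phi)) in *.
  destruct (Rtotal_order x (sqrt 5 / 5)) as [Hlt | [Heq | Hgt]].
  - right; split; [exact Hlt |].
    (* For [0 <= x < 1 / sqrt 5], [sqrt 5 / phi * x - phi] lies in [[- phi, -1)], so its floor is
       -2. *)
    apply (frac_part_unique _ _ (3 * a k + k - 2)).
    + rewrite Hc, (minus_IZR _ 2); unfold phi; lra.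
    + split; nra.
  - contradiction.
  - left; split; [exact Hgt |].
    (* For [1 / sqrt 5 < x < 1] it lies in [(-1, 2 - sqrt 5)], so its floor is -1. *)
    apply (frac_part_unique _ _ (3 * a k + k - 1)).
    + rewrite Hc, (minus_IZR _ 1); unfold phi; lra.
    + split; nra.
Qed.
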